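(* Let $R$ be a principal ideal domain with fraction field $K$, let $a,b,c$ be positive integers, and let $\mathbb{P}^1(a,b,c)$ be the base extension to $R$ of the Belyi stack of signature $(a,b,c)$. Under the natural map $\mathbb{P}^1(a,b,c)\langle R\rangle\to\mathbb{P}^1(R)=\mathbb{P}^1(K)$, the set $\mathbb{P}^1(a,b,c)\langle R\rangle$ surjects onto the subset of those $Q=(s:t)\in\mathbb{P}^1(R)$ such that either $Q\in\{P_0,P_1,P_\infty\}$, or all of the following hold: (1) $I(P_0,Q)=sR$ is an $a$-th power (of an ideal of $R$); (2) $I(P_1,Q)=(s-t)R$ is a $b$-th power; (3) $I(P_\infty,Q)=tR$ is a $c$-th power. This map is injective away from $\{P_0,P_1,P_\infty\}$, and its fibers over $P_0$, $P_1$, $P_\infty$ are torsors under $R^\times/(R^\times)^a$, $R^\times/(R^\times)^b$, $R^\times/(R^\times)^c$, respectively.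
   Context: Points of $\mathbb{P}^1(R)$, for $\mathbb{P}^1=\operatorname{Proj}R[\mathsf{s},\mathsf{t}]$, are written $(s:t)$ with $s,t\in R$ and $sR+tR=R$, up to simultaneous scaling by $R^\times$. For $P=(c':d')$ and $Q=(a':b')$ in $\mathbb{P}^1(R)$, the intersection ideal is $I(P,Q)=(a'd'-b'c')R$. The divisors (also viewed as $R$-points) are $P_0=V(\mathsf{s})=(0:1)$, $P_1=V(\mathsf{s}-\mathsf{t})=(1:1)$, $P_\infty=V(\mathsf{t})=(1:0)$. Root stacks: a generalized effective Cartier divisor on a scheme $X$ is a pair $(\mathcal{L},\rho)$ with $\mathcal{L}$ a line bundle and $\rho\colon\mathcal{L}\to\mathcal{O}_X$ an $\mathcal{O}_X$-linear map; an isomorphism $(\mathcal{L}',\rho')\cong(\mathcal{L},\rho)$ is an isomorphism of line bundles $\sigma\colon\mathcal{L}'\to\mathcal{L}$ with $\rho'=\rho\circ\sigma$. For an effective Cartier divisor $D\subset X$ with inclusion $j_D\colon\mathcal{O}_X(-D)\hookrightarrow\mathcal{O}_X$ and $r\ge1$, the root stack $\sqrt[r]{X;D}$ has as objects over $f\colon T\to X$ the pairs $((\mathcal{M},\lambda),\sigma)$, where $(\mathcal{M},\lambda)$ is a generalized effective Cartier divisor on $T$ and $\sigma\colon(\mathcal{M}^{\otimes r},\lambda^{\otimes r})\to(f^*\mathcal{O}_X(-D),f^*j_D)$ is an isomorphism of generalized effective Cartier divisors; morphisms over $T$ are isomorphisms $(\mathcal{M}',\lambda')\cong(\mathcal{M},\lambda)$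 whose $r$-th tensor power is compatible with $\sigma',\sigma$. Belyi stack: $\mathbb{P}^1(a,b,c)=\sqrt[a]{\mathbb{P}^1;P_0}\times_{\mathbb{P}^1}\sqrt[b]{\mathbb{P}^1;P_1}\times_{\mathbb{P}^1}\sqrt[c]{\mathbb{P}^1;P_\infty}$. Its groupoid of $R$-points is the disjoint union, over $Q\in\mathbb{P}^1(R)$ (viewed as a morphism $Q\colon\operatorname{Spec}R\to\mathbb{P}^1$), of the groupoids of objects over $Q$. For a stack $\mathscr{X}$, $\mathscr{X}\langle R\rangle$ denotes the set of isomorphism classes of the groupoid $\mathscr{X}(R)$. The natural map to $\mathbb{P}^1(R)$ sends an object over $Q$ to $Q$. *)

(* Defs.v *)
From HB Require Import structures.
From mathcomp Require Import all_boot all_algebra.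
From mathcomp Require Import generic_quotient.
From mathcomp Require Import boolp classical_sets.
Set Implicit Arguments.
Unset Strict Implicit.
Unset Printing Implicit Defensive.
Import GRing.Theory.
Local Open Scope ring_scope.
Local Open Scope quotient_scope.
Local Open Scope classical_set_scope.

Section Ideals.
Variable R : comNzRingType.
Implicit Types I J : set R.

Definition is_ideal I : Prop :=
  [/\ I 0, forall x y, I x -> I y -> I (x + y)
    & forall r x, I x -> I (r * x)].

Definition pideal (x : R) : set R := [set y | exists r, y = r * x].

Definition ideal_mul I J : set R :=
  [set z | exists2 w : seq (R * R),
     (forall p, p \in w -> I p.1 /\ J p.2) & z = \sum_(p <- w) p.1 * p.2].

Fixpoint ideal_pow I (n : nat) : set R :=
  if n is n'.+1 then ideal_mul I (ideal_pow I n') else setT.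

Definition is_ideal_power (n : nat) I : Prop :=
  exists2 J, is_ideal J & I = ideal_pow J n.

Definition is_pir : Prop := forall I, is_ideal I -> exists x, I = pideal x.
End Ideals.

Section ProjectiveLine.
Variable R : comUnitRingType.

Definition unimodular (v : R * R) : Prop :=
  exists x y, x * v.1 + y * v.2 = 1.

Definition unimod := {v : R * R | `[< unimodular v >]}.

Definition p1_rel (v w : unimod) : bool :=
  `[< exists2 k : R, k \is a GRing.unit &
        val w = (k * (val v).1, k * (val v).2) >].

Lemma p1_rel_refl : reflexive p1_rel.
Proof.
by move=> v; apply/asboolP; exists 1; rewrite ?unitr1 // !mul1r -surjective_pairing.
Qed.

Lemma p1_rel_sym : symmetric p1_rel.
Proof.
have H v w : p1_rel v w -> p1_rel w v.
  move=> /asboolP[k ku e]; apply/asboolP; exists k^-1; first by rewrite unitrV.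
  by rewrite e /= !mulKr // -surjective_pairing.
by move=> v w; apply/idP/idP; apply: H.
Qed.

Lemma p1_rel_trans : transitive p1_rel.
Proof.
move=> w v z /asboolP[k ku e] /asboolP[l lu e']; apply/asboolP.
exists (l * k); first by rewrite unitrM lu.
by rewrite e' e /= !mulrA.
Qed.

Canonical p1_equiv := EquivRel p1_rel p1_rel_refl p1_rel_sym p1_rel_trans.

Definition p1 := {eq_quot p1_equiv}.
HB.instance Definition _ := EqQuotient.on p1.
HB.instance Definition _ := Choice.on p1.

(* [p1_mk h] is the point (s : t) *)
Definition p1_mk (s t : R) (h : unimodular (s, t)) : p1 :=
  \pi_p1 (exist _ (s, t) (asboolT h) : unimod).

Definition p1_rep (Q : p1) : R * R := val (repr Q).

Lemma p1_repP (Q : p1) : unimodular (p1_rep Q).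
Proof. by apply/asboolP; exact: (valP (repr Q)). Qed.

Lemma p1_rep_mk (s t : R) (h : unimodular (s, t)) :
  exists2 k : R, k \is a GRing.unit & p1_rep (p1_mk h) = (k * s, k * t).
Proof.
have := reprK (p1_mk h); rewrite {2}/p1_mk => /esym/eqmodP/asboolP[k ku e].
by exists k.
Qed.

Lemma unimod01 : unimodular (0, 1).
Proof. by exists 0, 1; rewrite mulr0 add0r mulr1. Qed.
Lemma unimod11 : unimodular (1, 1).
Proof. by exists 0, 1; rewrite mul0r add0r mulr1. Qed.
Lemma unimod10 : unimodular (1, 0).
Proof. by exists 1, 0; rewrite mulr0 addr0 mulr1. Qed.

Definition P_0 : p1 := p1_mk unimod01.
Definition P_1 : p1 := p1_mk unimod11.
Definition P_oo : p1 := p1_mk unimod10.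

Definition inter_ideal (P Q : p1) : set R :=
  pideal ((p1_rep Q).1 * (p1_rep P).2 - (p1_rep Q).2 * (p1_rep P).1).
End ProjectiveLine.

Section P1Functor.
Variables (R S : comUnitRingType) (f : {rmorphism R -> S}).

Lemma unimodular_morph (v : R * R) :
  unimodular v -> unimodular (f v.1, f v.2).
Proof.
by case=> x [y e]; exists (f x), (f y); rewrite /= -!rmorphM -rmorphD e rmorph1.
Qed.

Definition p1_map (Q : p1 R) : p1 S := p1_mk (unimodular_morph (p1_repP Q)).
End P1Functor.

(* R^*/(R^* )^n, for not necessarily finite unit groups *)
Section UnitGroups.
Variable R : comUnitRingType.

Definition units := {x : R | x \is a GRing.unit}.
HB.instance Definition _ := Choice.on units.

Definition units1 : units := exist _ 1 (unitr1 R).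
Definition unitsM (u v : units) : units :=
  exist _ (val u * val v) (etrans (unitrMl _ (valP v)) (valP u)).
Definition unitsV (u : units) : units :=
  exist _ (val u)^-1 (etrans (unitrV _) (valP u)).

Fact unitsMA : associative unitsM.
Proof. by move=> u v w; apply: val_inj; rewrite /= mulrA. Qed.
Fact units1M : left_id units1 unitsM.
Proof. by move=> u; apply: val_inj; rewrite /= mul1r. Qed.
Fact unitsM1 : right_id units1 unitsM.
Proof. by move=> u; apply: val_inj; rewrite /= mulr1. Qed.
Fact unitsVM : left_inverse units1 unitsV unitsM.
Proof. by move=> u; apply: val_inj; rewrite /= mulVr ?(valP u). Qed.
Fact unitsMV : right_inverse units1 unitsV unitsM.
Proof. by move=> u; apply: val_inj; rewrite /= mulrV ?(valP u). Qed.

HB.instance Definition _ :=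
  isGroup.Build units unitsMA units1M unitsM1 unitsVM unitsMV.

Variable n : nat.

Definition umod_rel (u v : units) : bool :=
  `[< exists w : units, val v = val u * val w ^+ n >].

Lemma umod_rel_refl : reflexive umod_rel.
Proof. by move=> u; apply/asboolP; exists units1; rewrite /= expr1n mulr1. Qed.

Lemma umod_rel_sym : symmetric umod_rel.
Proof.
have H u v : umod_rel u v -> umod_rel v u.
  move=> /asboolP[w e]; apply/asboolP; exists (unitsV w).
  by rewrite e /= exprVn mulrK // unitrX // (valP w).
by move=> u v; apply/idP/idP; apply: H.
Qed.

Lemma umod_rel_trans : transitive umod_rel.
Proof.
move=> v u w /asboolP[x e] /asboolP[y e']; apply/asboolP; exists (unitsM x y).
by rewrite e' e /= exprMn mulrA.
Qed.

Canonical umod_equiv :=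
  EquivRel umod_rel umod_rel_refl umod_rel_sym umod_rel_trans.

Definition units_mod := {eq_quot umod_equiv}.
HB.instance Definition _ := EqQuotient.on units_mod.
HB.instance Definition _ := Choice.on units_mod.

Definition to_units_mod (u : units) : units_mod := \pi_units_mod u.

Lemma to_units_modP u v :
  to_units_mod u = to_units_mod v <->
  exists w : units, val v = val u * val w ^+ n.
Proof. by split=> [/eqmodP/asboolP|h] //; apply/eqmodP/asboolP. Qed.

Definition umodM (x y : units_mod) := to_units_mod (unitsM (repr x) (repr y)).
Definition umodV (x : units_mod) := to_units_mod (unitsV (repr x)).

Lemma to_units_modM u v :
  to_units_mod (unitsM u v) = umodM (to_units_mod u) (to_units_mod v).
Proof.
have [x ex] := (to_units_modP _ _).1 (esym (reprK (to_units_mod u))).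
have [y ey] := (to_units_modP _ _).1 (esym (reprK (to_units_mod v))).
apply/to_units_modP; exists (unitsM x y).
by rewrite /= ex ey exprMn mulrACA.
Qed.

Lemma to_units_modV u : to_units_mod (unitsV u) = umodV (to_units_mod u).
Proof.
have [x ex] := (to_units_modP _ _).1 (esym (reprK (to_units_mod u))).
apply/to_units_modP; exists (unitsV x).
by rewrite /= ex exprVn invrM ?unitrX ?(valP u) ?(valP x) // mulrC.
Qed.

Fact umodMA : associative umodM.
Proof.
move=> x y z; rewrite -[x]reprK -[y]reprK -[z]reprK.
by rewrite -!/(to_units_mod _) -!to_units_modM unitsMA.
Qed.
Fact umod1M : left_id (to_units_mod units1) umodM.
Proof. by move=> x; rewrite -[x]reprK -!/(to_units_mod _) -to_units_modM units1M. Qed.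
Fact umodM1 : right_id (to_units_mod units1) umodM.
Proof. by move=> x; rewrite -[x]reprK -!/(to_units_mod _) -to_units_modM unitsM1. Qed.
Fact umodVM : left_inverse (to_units_mod units1) umodV umodM.
Proof.
move=> x; rewrite -[x]reprK -!/(to_units_mod _) -to_units_modV -to_units_modM.
by rewrite unitsVM.
Qed.
Fact umodMV : right_inverse (to_units_mod units1) umodV umodM.
Proof.
move=> x; rewrite -[x]reprK -!/(to_units_mod _) -to_units_modV -to_units_modM.
by rewrite unitsMV.
Qed.

HB.instance Definition _ :=
  isGroup.Build units_mod umodMA umod1M umodM1 umodVM umodMV.
End UnitGroups.

Definition is_torsor (G : groupType) (X : Type) (act : G -> X -> X) : Prop :=
  [/\ inhabited X,
      forall x, act 1%g x = x,
      forall g h x, act (g * h)%g x = act g (act h x)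
    & forall x y, exists! g, act g x = y].

(* The tensor product of modules: finite formal sums of pure tensors, modulo
   the congruence generated by biadditivity and R-balancedness. *)
Section Tensor.
Variables (R : comNzRingType) (M N : lmodType R).

Inductive tens_eq : seq (M * N) -> seq (M * N) -> Prop :=
| Tens_refl w : tens_eq w w
| Tens_sym w1 w2 : tens_eq w1 w2 -> tens_eq w2 w1
| Tens_trans w1 w2 w3 : tens_eq w1 w2 -> tens_eq w2 w3 -> tens_eq w1 w3
| Tens_cat w1 w1' w2 w2' :
    tens_eq w1 w1' -> tens_eq w2 w2' -> tens_eq (w1 ++ w2) (w1' ++ w2')
| Tens_catC w1 w2 : tens_eq (w1 ++ w2) (w2 ++ w1)
| Tens_0 n : tens_eq [:: (0, n)] [::]
| Tens_Dl m m' n : tens_eq [:: (m + m', n)] [:: (m, n); (m', n)]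
| Tens_Dr m n n' : tens_eq [:: (m, n + n')] [:: (m, n); (m, n')]
| Tens_Z r m n : tens_eq [:: (r *: m, n)] [:: (m, r *: n)].

Definition tens_rel (w1 w2 : seq (M * N)) : bool := `[< tens_eq w1 w2 >].

Lemma tens_rel_refl : reflexive tens_rel.
Proof. by move=> w; apply/asboolP; apply: Tens_refl. Qed.
Lemma tens_rel_sym : symmetric tens_rel.
Proof.
by move=> v w; apply/idP/idP => /asboolP h; apply/asboolP; apply: Tens_sym.
Qed.
Lemma tens_rel_trans : transitive tens_rel.
Proof.
by move=> w v z /asboolP h /asboolP h'; apply/asboolP; apply: Tens_trans h h'.
Qed.

Canonical tens_equiv :=
  EquivRel tens_rel tens_rel_refl tens_rel_sym tens_rel_trans.

Definition tens := {eq_quot tens_equiv}.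
HB.instance Definition _ := EqQuotient.on tens.
HB.instance Definition _ := Choice.on tens.

Definition tens_of (w : seq (M * N)) : tens := \pi_tens w.

Lemma tens_ofP w1 w2 : tens_of w1 = tens_of w2 <-> tens_eq w1 w2.
Proof. by split=> [/eqmodP/asboolP|h] //; apply/eqmodP/asboolP. Qed.

Lemma tens_repr w : tens_eq (repr (tens_of w)) w.
Proof. by apply/tens_ofP; rewrite /tens_of reprK. Qed.

Lemma tens_ind (P : tens -> Prop) : (forall w, P (tens_of w)) -> forall x, P x.
Proof. by move=> H x; rewrite -[x]reprK; apply: H. Qed.

Definition word_scale (r : R) (w : seq (M * N)) := [seq (r *: p.1, p.2) | p <- w].

Lemma word_scale_eq r w1 w2 :
  tens_eq w1 w2 -> tens_eq (word_scale r w1) (word_scale r w2).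
Proof.
elim=> {w1 w2}.
- by move=> w; apply: Tens_refl.
- by move=> w1 w2 _; apply: Tens_sym.
- by move=> w1 w2 w3 _ h _; apply: Tens_trans.
- by move=> w1 w1' w2 w2' _ h _ h'; rewrite /word_scale !map_cat; apply: Tens_cat.
- by move=> w1 w2; rewrite /word_scale !map_cat; apply: Tens_catC.
- by move=> n; rewrite /= scaler0; apply: Tens_0.
- by move=> m m' n; rewrite /= scalerDr; apply: Tens_Dl.
- by move=> m n n'; apply: Tens_Dr.
- by move=> s m n; rewrite /= scalerA mulrC -scalerA; apply: Tens_Z.
Qed.

Definition tens_add (x y : tens) := tens_of (repr x ++ repr y).
Definition tens_scale (r : R) (x : tens) := tens_of (word_scale r (repr x)).
Definition tens_opp (x : tens) := tens_scale (-1) x.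

Lemma tens_of_cat w1 w2 : tens_of (w1 ++ w2) = tens_add (tens_of w1) (tens_of w2).
Proof. by apply/tens_ofP/Tens_sym; apply: Tens_cat; apply: tens_repr. Qed.
Lemma tens_of_scale r w : tens_of (word_scale r w) = tens_scale r (tens_of w).
Proof. by apply/tens_ofP/Tens_sym; apply/word_scale_eq/tens_repr. Qed.

Fact tens_addA : associative tens_add.
Proof.
move=> x y z; elim/tens_ind: x => x; elim/tens_ind: y => y; elim/tens_ind: z => z.
by rewrite -!tens_of_cat catA.
Qed.
Fact tens_addC : commutative tens_add.
Proof.
move=> x y; elim/tens_ind: x => x; elim/tens_ind: y => y.
by rewrite -!tens_of_cat; apply/tens_ofP/Tens_catC.
Qed.
Fact tens_add0 : left_id (tens_of [::]) tens_add.
Proof. by move=> x; elim/tens_ind: x => x; rewrite -tens_of_cat. Qed.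

Fact tens_scaleDl' r s x :
  tens_scale (r + s) x = tens_add (tens_scale r x) (tens_scale s x).
Proof.
elim/tens_ind: x => w; rewrite -!tens_of_scale.
elim: w => [|[m n] w IH] /=; first by rewrite tens_add0.
rewrite -cat1s tens_of_cat IH -[(r *: m, n) :: _]cat1s -[(s *: m, n) :: _]cat1s.
rewrite scalerDl ((tens_ofP _ _).2 (Tens_Dl (r *: m) _ _)) -[[:: _; _]]cat1s.
rewrite !tens_of_cat -!tens_addA; congr tens_add.
by rewrite !tens_addA; congr tens_add; apply: tens_addC.
Qed.

Fact tens_scale0 x : tens_scale 0 x = tens_of [::].
Proof.
elim/tens_ind: x => w; rewrite -tens_of_scale; elim: w => [|[m n] w IH] //=.
rewrite -cat1s tens_of_cat IH tens_addC tens_add0 scale0r.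
exact/tens_ofP/Tens_0.
Qed.

Fact tens_scale1 : left_id 1 tens_scale.
Proof.
move=> x; elim/tens_ind: x => w; rewrite -tens_of_scale; congr tens_of.
by rewrite -[RHS]map_id; apply: eq_map => -[m n]; rewrite /= scale1r.
Qed.

Fact tens_addN : left_inverse (tens_of [::]) tens_opp tens_add.
Proof.
by move=> x; rewrite -{2}[x]tens_scale1 -tens_scaleDl' addNr tens_scale0.
Qed.

HB.instance Definition _ :=
  GRing.isZmodule.Build tens tens_addA tens_addC tens_add0 tens_addN.

Fact tens_scaleA r s x : tens_scale r (tens_scale s x) = tens_scale (r * s) x.
Proof.
elim/tens_ind: x => w; rewrite -!tens_of_scale; congr tens_of.
by rewrite /word_scale -map_comp; apply: eq_map => -[m n]; rewrite /= scalerA.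
Qed.
Fact tens_scaleDr : right_distributive tens_scale +%R.
Proof.
move=> r x y; elim/tens_ind: x => x; elim/tens_ind: y => y.
by rewrite -[_ + _]tens_of_cat -!tens_of_scale -[_ + _]tens_of_cat /word_scale map_cat.
Qed.
Fact tens_scaleDl x : {morph tens_scale^~ x : r s / r + s}.
Proof. by move=> r s; apply: tens_scaleDl'. Qed.

HB.instance Definition _ := GRing.Zmodule_isLmodule.Build R tens
  tens_scaleA tens_scale1 tens_scaleDr tens_scaleDl.

Definition tmul (m : M) (n : N) : tens := tens_of [:: (m, n)].

Lemma tens_ofE w : tens_of w = \sum_(p <- w) tmul p.1 p.2.
Proof.
elim: w => [|[m n] w IH]; first by rewrite big_nil.
by rewrite big_cons -IH -cat1s tens_of_cat.
Qed.

Section Lift.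
Variable P : lmodType R.

Definition bilinear (f : M -> N -> P) : Prop :=
  (forall m, linear (f m)) /\ (forall n, linear (f^~ n)).

Variables (f : M -> N -> P) (bf : bilinear f).

Definition word_eval (w : seq (M * N)) : P := \sum_(p <- w) f p.1 p.2.

Lemma word_eval_eq w1 w2 : tens_eq w1 w2 -> word_eval w1 = word_eval w2.
Proof.
case: bf => fr fl.
have fD m m' n : f (m + m') n = f m n + f m' n.
  by have := fl n 1 m m'; rewrite !scale1r.
have f0 n : f 0 n = 0 by apply: (addrI (f 0 n)); rewrite -fD !addr0.
have fD' m n n' : f m (n + n') = f m n + f m n'.
  by have := fr m 1 n n'; rewrite !scale1r.
have f0' m : f m 0 = 0 by apply: (addrI (f m 0)); rewrite -fD' !addr0.
rewrite /word_eval; elim=> {w1 w2} //=.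
- by move=> w1 w2 w3 _ -> _ ->.
- by move=> w1 w1' w2 w2' _ h _ h'; rewrite !big_cat /= h h'.
- by move=> w1 w2; rewrite !big_cat /= addrC.
- by move=> n; rewrite big_seq1 big_nil f0.
- by move=> m m' n; rewrite big_seq1 big_cons big_seq1 fD.
- by move=> m n n'; rewrite big_seq1 big_cons big_seq1 fD'.
- move=> r m n; rewrite !big_seq1 /=.
  have := fl n r m 0; have := fr m r n 0.
  by rewrite !addr0 f0 f0' !addr0 => -> ->.
Qed.

Definition tens_lift (_ : bilinear f) (x : tens) : P := word_eval (repr x).

Lemma tens_lift_of w : tens_lift bf (tens_of w) = word_eval w.
Proof. exact/word_eval_eq/tens_repr. Qed.

Lemma tens_liftE m n : tens_lift bf (tmul m n) = f m n.
Proof. by rewrite tens_lift_of /word_eval big_seq1. Qed.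

Fact tens_lift_linear : linear (tens_lift bf).
Proof.
move=> r x y; elim/tens_ind: x => x; elim/tens_ind: y => y.
rewrite -[r *: _]tens_of_scale -[_ + _]tens_of_cat !tens_lift_of /word_eval.
rewrite big_cat big_map scaler_sumr; congr (_ + _); apply: eq_bigr => p _ /=.
have := bf.2 p.2 r p.1 0; have := bf.2 p.2 (-1) 0 0.
by rewrite addr0 scaler0 addr0 scaleN1r addNr => ->; rewrite !addr0.
Qed.
End Lift.
End Tensor.

HB.instance Definition _ (R : comNzRingType) (M N P : lmodType R)
    (f : M -> N -> P) (bf : bilinear f) :=
  GRing.isLinear.Build R (tens M N) P *:%R (tens_lift bf) (tens_lift_linear bf).

Section TensorFunctor.
Variable R : comNzRingType.

Fact tens_map_bilinear (M N M' N' : lmodType R)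
    (f : {linear M -> M'}) (g : {linear N -> N'}) :
  bilinear (fun m n => tmul (f m) (g n)).
Proof.
split=> [m|n] r x y; rewrite linearP.
- rewrite -[r *: tmul _ _]tens_of_scale -[RHS]tens_of_cat; apply/tens_ofP => /=.
  apply: Tens_trans (Tens_Dr _ _ _) _; rewrite -[X in tens_eq X]cat1s -[X in tens_eq _ X]cat1s.
  apply: Tens_cat; [apply/Tens_sym/Tens_Z | exact: Tens_refl].
- rewrite -[r *: tmul _ _]tens_of_scale -[RHS]tens_of_cat; apply/tens_ofP => /=.
  exact: Tens_Dl.
Qed.

Definition tens_map (M N M' N' : lmodType R)
    (f : {linear M -> M'}) (g : {linear N -> N'}) :
    {linear tens M N -> tens M' N'} :=
  tens_lift (tens_map_bilinear f g).

Fact tens_form_bilinear (M N : lmodType R)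
    (f : {linear M -> R^o}) (g : {linear N -> R^o}) :
  bilinear (fun m n => f m * g n : R^o).
Proof.
split=> [m|n] r x y; rewrite linearP /GRing.scale /=.
- by rewrite mulrDr mulrCA.
- by rewrite mulrDl mulrA.
Qed.

Definition tens_form (M N : lmodType R)
    (f : {linear M -> R^o}) (g : {linear N -> R^o}) :
    {linear tens M N -> R^o} :=
  tens_lift (tens_form_bilinear f g).

Fixpoint tpow (M : lmodType R) (n : nat) : lmodType R :=
  if n is n'.+1 then tens M (tpow M n') else R^o.

Fixpoint tpow_map (M M' : lmodType R) (f : {linear M -> M'}) (n : nat) :
    {linear tpow M n -> tpow M' n} :=
  match n with
  | 0 => idfun
  | n'.+1 => tens_map f (tpow_map f n')
  end.

(* the n-th tensor power of a form, composed with (R^o)^{(x) n} = R^o *)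
Fixpoint tpow_form (M : lmodType R) (f : {linear M -> R^o}) (n : nat) :
    {linear tpow M n -> R^o} :=
  match n with
  | 0 => idfun
  | n'.+1 => tens_form f (tpow_form f n')
  end.

(* line bundles on Spec R *)
Definition invertible_module (M : lmodType R) : Prop :=
  exists (N : lmodType R) (f : {linear tens M N -> R^o}), bijective f.
End TensorFunctor.

Section RootStack.
Variable R : comNzRingType.

(* A generalized effective Cartier divisor on Spec R is a [modform] whose
   module is invertible. *)
Record modform := ModForm {
  mf_mod :> lmodType R;
  mf_form : {linear mf_mod -> R^o} }.

Definition modform_pow (D : modform) (r : nat) : modform :=
  ModForm (tpow_form (mf_form D) r).

Definition is_modform_iso (D' D : modform) (f : {linear D' -> D}) : Prop :=
  bijective f /\ forall x, mf_form D' x = mf_form D (f x).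

(* the objects over Spec R -> X of the r-th root stack of X along a divisor
   whose pullback to Spec R is D *)
Record root_obj (D : modform) (r : nat) := RootObj {
  ro_div :> modform;
  ro_inv : invertible_module ro_div;
  ro_sigma : {linear modform_pow ro_div r -> D};
  ro_iso : is_modform_iso ro_sigma }.

Definition is_root_iso (D : modform) (r : nat) (y' y : root_obj D r)
    (f : {linear y' -> y}) : Prop :=
  is_modform_iso f /\
  forall x, ro_sigma y' x = ro_sigma y (tpow_map f r x).

Definition root_isom (D : modform) (r : nat) (y' y : root_obj D r) : Prop :=
  exists f : {linear y' -> y}, is_root_iso f.
End RootStack.

(* When the form of D vanishes, rescaling sigma by a unit gives again an object:
   this is the source of the torsor structure on the fibers. *)
Section Twist.
Variables (R : comUnitRingType) (D : modform R) (r : nat).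
Hypothesis D0 : forall x, mf_form D x = 0.

Definition twist_sigma (u : units R) (y : root_obj D r) :
    {linear modform_pow y r -> D} := (val u) \*: ro_sigma y.

Fact twist_iso u y : is_modform_iso (twist_sigma u y).
Proof.
case: (ro_iso y) => -[g gK Kg] e; split=> [|x]; last by rewrite e !D0.
exists (fun x => g ((val u)^-1 *: x)) => x /=.
- by rewrite scalerA mulVr ?(valP u) // scale1r gK.
- by rewrite Kg scalerA mulrV ?(valP u) // scale1r.
Qed.

Definition root_twist (u : units R) (y : root_obj D r) : root_obj D r :=
  RootObj (ro_inv y) (twist_iso u y).
End Twist.

(* Pullbacks of divisors of P^1 along Q : Spec R -> P^1. If Q = (s : t), the
   pullback of O(-1), with its inclusion in O^2, is the line R(s, t) in R^2. For
   D = V(F), F a linear form, multiplication by F identifies O(-1) with O(-D),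
   so the pullback of j_D : O(-D) -> O is the restriction of F to the line. *)
Section Pullback.
Variable R : comUnitRingType.

Definition in_line (Q : p1 R) : {pred (R^o * R^o)%type} :=
  fun v => `[< exists r : R, v = (r * (p1_rep Q).1, r * (p1_rep Q).2) >].

Fact in_line_submod Q : submod_closed (in_line Q).
Proof.
split; first by apply/asboolP; exists 0; rewrite !mul0r.
move=> k v w /asboolP[r ->] /asboolP[s ->]; apply/asboolP; exists (k * r + s).
by rewrite !mulrDl -!mulrA.
Qed.

HB.instance Definition _ Q :=
  GRing.isSubmodClosed.Build R (R^o * R^o)%type (in_line Q) (in_line_submod Q).

Definition line (Q : p1 R) := {v : (R^o * R^o)%type | v \in in_line Q}.
HB.instance Definition _ Q := SubChoice.on (line Q).
HB.instance Definition _ Q := [SubChoice_isSubLmodule of line Q by <:].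

Lemma in_line_mk (s t : R) (h : unimodular (s, t)) (v : R^o * R^o) :
  v \in in_line (p1_mk h) <-> exists r : R, v = (r * s, r * t).
Proof.
have [k ku e] := p1_rep_mk h; split.
- by move=> /asboolP[r]; rewrite e /= !mulrA => ->; exists (r * k).
- case=> r ->; apply/asboolP; exists (r * k^-1); rewrite e /=.
  by rewrite !mulrA !mulrVK.
Qed.

Definition form_0 (v : R^o * R^o) : R^o := v.1.
Definition form_1 (v : R^o * R^o) : R^o := v.1 - v.2.
Definition form_oo (v : R^o * R^o) : R^o := v.2.

Fact form_0_linear : linear form_0. Proof. by []. Qed.
Fact form_1_linear : linear form_1.
Proof. by move=> k v w; rewrite /form_1 /= scalerBr opprD addrACA. Qed.
Fact form_oo_linear : linear form_oo. Proof. by []. Qed.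
HB.instance Definition _ :=
  GRing.isLinear.Build R (R^o * R^o)%type R^o *:%R form_0 form_0_linear.
HB.instance Definition _ :=
  GRing.isLinear.Build R (R^o * R^o)%type R^o *:%R form_1 form_1_linear.
HB.instance Definition _ :=
  GRing.isLinear.Build R (R^o * R^o)%type R^o *:%R form_oo form_oo_linear.

Definition pullback_div (F : {linear (R^o * R^o)%type -> R^o}) (Q : p1 R) :
  modform R := @ModForm R (line Q) (F \o val).

Lemma form_0_P0 (x : pullback_div form_0 (P_0 R)) : mf_form _ x = 0.
Proof.
by have /in_line_mk[r e] := valP x; rewrite /= e /form_0 /= mulr0.
Qed.
Lemma form_1_P1 (x : pullback_div form_1 (P_1 R)) : mf_form _ x = 0.
Proof.
by have /in_line_mk[r e] := valP x; rewrite /= e /form_1 /= subrr.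
Qed.
Lemma form_oo_Poo (x : pullback_div form_oo (P_oo R)) : mf_form _ x = 0.
Proof.
by have /in_line_mk[r e] := valP x; rewrite /= e /form_oo /= mulr0.
Qed.
End Pullback.

Section BelyiStack.
Variables (R : comUnitRingType) (a b c : nat).

Record belyi_obj (Q : p1 R) := BelyiObj {
  bel_0 : root_obj (pullback_div (@form_0 R) Q) a;
  bel_1 : root_obj (pullback_div (@form_1 R) Q) b;
  bel_oo : root_obj (pullback_div (@form_oo R) Q) c }.

Definition belyi_pt := {Q : p1 R & belyi_obj Q}.

Inductive belyi_isom : belyi_pt -> belyi_pt -> Prop :=
  BelyiIsom Q (y' y : belyi_obj Q) :
    root_isom (bel_0 y') (bel_0 y) ->
    root_isom (bel_1 y') (bel_1 y) ->
    root_isom (bel_oo y') (bel_oo y) ->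
    belyi_isom (existT _ Q y') (existT _ Q y).

(* isomorphism classes of R-points, as sets of isomorphic objects *)
Definition belyi_class :=
  {C : belyi_pt -> Prop | exists x, C = belyi_isom^~ x}.

Definition to_class (x : belyi_pt) : belyi_class :=
  exist _ (belyi_isom^~ x) (ex_intro _ x erefl).

Definition class_rep (C : belyi_class) : belyi_pt := projT1 (cid (svalP C)).

Definition belyi_proj (C : belyi_class) : p1 R := projT1 (class_rep C).

Lemma root_isom_refl (D : modform R) r (y : root_obj D r) : root_isom y y.
Proof.
exists idfun; split; first by split=> //; exists id.
suff H : forall n, tpow_map (idfun : {linear y -> y}) n =1 id.
  by move=> x; rewrite H.
elim=> [|n IH] x //=; elim/tens_ind: x => w.
rewrite [LHS]tens_lift_of tens_ofE /word_eval.
by apply: eq_bigr => p _; rewrite IH.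
Qed.

Lemma belyi_isom_refl x : belyi_isom x x.
Proof. by case: x => Q y; apply: BelyiIsom; apply: root_isom_refl. Qed.

Lemma belyi_isom_base x y : belyi_isom x y -> projT1 x = projT1 y.
Proof. by case. Qed.

Lemma belyi_proj_class x : belyi_proj (to_class x) = projT1 x.
Proof.
rewrite /belyi_proj /class_rep; case: cid => z /= e.
by apply/esym/belyi_isom_base; rewrite -[belyi_isom x z]/((belyi_isom^~ z) x) -e;
   apply: belyi_isom_refl.
Qed.

Definition belyi_fiber (Q : p1 R) := {C : belyi_class | belyi_proj C = Q}.

Definition to_fiber (Q : p1 R) (y : belyi_obj Q) : belyi_fiber Q :=
  exist _ (to_class (existT _ Q y)) (belyi_proj_class (existT _ Q y)).

Definition twist_0 (u : units R) (y : belyi_obj (P_0 R)) : belyi_obj (P_0 R) :=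
  BelyiObj (root_twist (@form_0_P0 R) u (bel_0 y)) (bel_1 y) (bel_oo y).
Definition twist_1 (u : units R) (y : belyi_obj (P_1 R)) : belyi_obj (P_1 R) :=
  BelyiObj (bel_0 y) (root_twist (@form_1_P1 R) u (bel_1 y)) (bel_oo y).
Definition twist_oo (u : units R) (y : belyi_obj (P_oo R)) : belyi_obj (P_oo R) :=
  BelyiObj (bel_0 y) (bel_1 y) (root_twist (@form_oo_Poo R) u (bel_oo y)).
End BelyiStack.

(* Main.v *)
(* Over a PID every line bundle on Spec R is trivial, so once a generator d of the
   pulled back O(-D) is fixed, with image delta in R, an object of the r-th root
   stack is a pair (l, u) with u a unit and l^r = u delta, and an isomorphism is a
   unit w acting by (l, u) -> (w l, w^r u). Such a pair exists iff delta R is an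
   r-th power; if delta <> 0, unique factorization makes any two pairs
   isomorphic; if delta = 0, then l = 0 and u is free, which leaves R^* modulo
   r-th powers. *)

Require Import Defs.
From HB Require Import structures.
From mathcomp Require Import all_boot all_algebra.
From mathcomp Require Import generic_quotient ring.
From mathcomp Require Import boolp classical_sets.
Set Implicit Arguments.
Unset Strict Implicit.
Unset Printing Implicit Defensive.
Import GRing.Theory.
Local Open Scope ring_scope.

(** * Tensor powers of free modules of rank one *)

Section TensorBasis.
Variable R : comNzRingType.

Lemma tmulZl (M N : lmodType R) r (m : M) (n : N) :
  tmul (r *: m) n = r *: tmul m n.
Proof. by rewrite -[RHS]tens_of_scale. Qed.

Lemma tmulZr (M N : lmodType R) r (m : M) (n : N) :
  tmul m (r *: n) = r *: tmul m n.
Proof. by rewrite -tmulZl; apply/esym/tens_ofP/Tens_Z. Qed.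

Lemma tmulDr (M N : lmodType R) (m : M) (n n' : N) :
  tmul m (n + n') = tmul m n + tmul m n'.
Proof. by rewrite -[RHS]tens_of_cat; apply/tens_ofP/Tens_Dr. Qed.

Lemma tmulDl (M N : lmodType R) (m m' : M) (n : N) :
  tmul (m + m') n = tmul m n + tmul m' n.
Proof. by rewrite -[RHS]tens_of_cat; apply/tens_ofP/Tens_Dl. Qed.

Lemma tmul0l (M N : lmodType R) (n : N) : tmul (0 : M) n = 0.
Proof. by rewrite -(scale0r (0 : M)) tmulZl scale0r. Qed.

(** A generator is kept together with its coordinate form, so that inverse maps can be written down
    explicitly and linear maps compared at [e] alone. *)
Definition is_basis1 (M : lmodType R) (e : M) (phi : {linear M -> R^o}) : Prop :=
  phi e = 1 /\ forall x, x = phi x *: e.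

Fixpoint tpow_gen (M : lmodType R) (e : M) (n : nat) : tpow M n :=
  match n with 0 => (1 : R^o) | n'.+1 => tmul e (tpow_gen e n') end.

Lemma tens_map_tmul (M N M' N' : lmodType R) (f : {linear M -> M'})
  (g : {linear N -> N'}) m n : tens_map f g (tmul m n) = tmul (f m) (g n).
Proof. exact: (tens_liftE (tens_map_bilinear f g)). Qed.

Lemma tens_form_tmul (M N : lmodType R) (f : {linear M -> R^o})
  (g : {linear N -> R^o}) m n : tens_form f g (tmul m n) = f m * g n :> R.
Proof. exact: (tens_liftE (tens_form_bilinear f g)). Qed.

Lemma basis1_tens (M N : lmodType R) (e : M) (phi : {linear M -> R^o})
    (e' : N) (psi : {linear N -> R^o}) :
  is_basis1 e phi -> is_basis1 e' psi ->
  is_basis1 (tmul e e') (tens_form phi psi).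
Proof.
move=> [h1 he] [h1' he']; split; first by rewrite tens_form_tmul h1 h1' mulr1.
move=> x; elim/tens_ind: x => w.
rewrite tens_ofE linear_sum scaler_suml; apply: eq_bigr => -[m n] _ /=.
by rewrite tens_form_tmul {1}(he m) {1}(he' n) tmulZl tmulZr scalerA.
Qed.

Lemma basis1_regular : is_basis1 (1 : R^o) (idfun : {linear R^o -> R^o}).
Proof. by split=> // x; rewrite /GRing.scale /= mulr1. Qed.

Lemma basis1_tpow (M : lmodType R) (e : M) (phi : {linear M -> R^o}) n :
  is_basis1 e phi -> is_basis1 (tpow_gen e n) (tpow_form phi n).
Proof.
by move=> b; elim: n => [|n IH]; [exact: basis1_regular | exact: basis1_tens].
Qed.

Lemma tpow_form_gen (M : lmodType R) (e : M) (f : {linear M -> R^o}) n :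
  tpow_form f n (tpow_gen e n) = (f e : R) ^+ n.
Proof. by elim: n => [|n IH] //; rewrite exprS -IH; apply: tens_form_tmul. Qed.

Lemma tpow_map_gen (M M' : lmodType R) (f : {linear M -> M'}) e e' w n :
  f e = w *: e' -> tpow_map f n (tpow_gen e n) = w ^+ n *: tpow_gen e' n.
Proof.
move=> fe; elim: n => [|n IH]; first by rewrite expr0 scale1r.
by rewrite [LHS]tens_map_tmul IH fe tmulZl tmulZr scalerA exprS.
Qed.

Lemma basis1_linear_ext (M N : lmodType R) (e : M) (phi : {linear M -> R^o})
    (f g : {linear M -> N}) : is_basis1 e phi -> f e = g e -> f =1 g.
Proof. by move=> [_ he] fg x; rewrite (he x) !linearZ /= fg. Qed.

Lemma basis1_bij (M : lmodType R) (e : M) (phi : {linear M -> R^o}) :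
  is_basis1 e phi -> bijective phi.
Proof.
move=> [h1 hx]; exists (fun r : R^o => r *: e) => x; first by rewrite -hx.
by rewrite linearZ /= h1 /GRing.scale /= mulr1.
Qed.

Lemma invertible_regular : invertible_module (R^o : lmodType R).
Proof.
exists R^o, (tens_form idfun idfun).
exact: basis1_bij (basis1_tens basis1_regular basis1_regular).
Qed.
End TensorBasis.

(** * Invertible modules over a principal ideal domain are free of rank one *)

Section InvertiblePID.
Variables (R : idomainType) (M N : lmodType R) (f : {linear tens M N -> R^o}).
Hypothesis bf : bijective f.

(* A bilinear map on M x N factors through f, so (m', n) |-> f(m (x) n) m' is a
   multiple of f. *)
Lemma invertible_swap (m : M) :
  exists p : M, forall m' n, f (tmul m n) *: m' = f (tmul m' n) *: p.
Proof.
have [g fK gK] := bf.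
have bl : Defs.bilinear (fun (m' : M) (n : N) => f (tmul m n) *: m').
  split=> [m'|n] r x y.
    by rewrite tmulDr tmulZr linearP scalerDl scalerA.
  by rewrite scalerDr !scalerA mulrC.
exists (tens_lift bl (g 1)) => m' n.
rewrite -[LHS](tens_liftE bl) -linearZ /=; congr tens_lift.
by apply: (can_inj fK); rewrite linearZ /= gK /GRing.scale /= mulr1.
Qed.

Lemma invertible_unit :
  exists w : seq (M * N), \sum_(p <- w) f (tmul p.1 p.2) = 1 :> R.
Proof.
have [g fK gK] := bf; exists (repr (g 1)).
by rewrite -linear_sum -tens_ofE /tens_of reprK.
Qed.

(** If 1 is the sum of the f(m_i, n_i), then x is the sum of the f(m_i, n_i) x, and
    [invertible_swap] turns each term into f(x, n_i) q_i. *)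
Lemma invertible_nondegenerate (x : M) : (forall n, f (tmul x n) = 0) -> x = 0.
Proof.
move=> fx0; have [w w1] := invertible_unit.
rewrite -[x]scale1r -w1 scaler_suml big1 // => p _.
by have [q hq] := invertible_swap p.1; rewrite hq fx0 scale0r.
Qed.

Lemma invertible_torsion_free (r : R) (x : M) : r != 0 -> r *: x = 0 -> x = 0.
Proof.
move=> r0 rx; apply: invertible_nondegenerate => n.
have : f (r *: tmul x n) = 0 by rewrite -tmulZl rx tmul0l linear0.
by rewrite linearZ => /eqP; rewrite mulf_eq0 (negbTE r0) => /eqP.
Qed.

(** Values on pure tensors sum to 1, so some f(m, n) is nonzero. By the swap, f(m, n) x = f(x, n) q,
    so f(x, n) = 0 makes x a torsion element, hence zero. *)
Lemma invertible_injective :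
  exists n, forall x : M, f (tmul x n) = 0 -> x = 0.
Proof.
have [w w1] := invertible_unit.
have [[p hp]|H] := pselect (exists p : M * N, f (tmul p.1 p.2) <> 0); last first.
  case/eqP: (oner_neq0 R); rewrite -w1 big1 // => p _.
  by apply: contrapT => hp; apply: H; exists p.
exists p.2 => x fx; have [q hq] := invertible_swap p.1.
apply: (@invertible_torsion_free (f (tmul p.1 p.2))); first exact/eqP.
by rewrite hq fx scale0r.
Qed.
End InvertiblePID.

(** Pairing with a suitable n embeds M in R. The image is an ideal, hence principal, and the element
    over its generator generates M. *)
Lemma invertible_basis1 (R : idomainType) (hR : is_pir R) (M : lmodType R) :
  invertible_module M -> exists (e : M) (phi : {linear M -> R^o}), is_basis1 e phi.
Proof.
move=> [N [f bf]]; have [n inj] := invertible_injective bf.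
pose h (x : M) : R^o := f (tmul x n).
have hD x y : h (x + y) = h x + h y.
  by rewrite /h tmulDl linearD.
have hZ r x : h (r *: x) = r * h x by rewrite /h tmulZl linearZ.
have hI : injective h.
  move=> x y e; apply/eqP; rewrite -subr_eq0; apply/eqP/inj.
  by rewrite -[LHS]/(h _) hD -scaleN1r hZ mulN1r e subrr.
have idl : is_ideal [set r : R | exists x, h x = r].
  split.
  - by exists 0; rewrite -(scale0r (0 : M)) hZ mul0r.
  - by move=> _ _ [x <-] [y <-]; exists (x + y).
  - by move=> r _ [x <-]; exists (r *: x).
have [g hg] := hR _ idl.
have [e he] : exists e, h e = g.
  have : pideal g g by exists 1; rewrite mul1r.
  by rewrite -hg.
have H x : exists r, x = r *: e.
  have : pideal g (h x) by rewrite -hg; exists x.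
  by case=> r hr; exists r; apply: hI; rewrite hZ he.
(* If e were zero, so would be M, and 1 could not be a sum of values of f. *)
have e0 : e != 0.
  apply/eqP => e0; have [w w1] := invertible_unit bf.
  case/eqP: (oner_neq0 R); rewrite -w1 big1 // => p _.
  have [r ->] := H p.1; rewrite e0 scaler0.
  by rewrite tmul0l linear0.
(* Coefficients are picked by choice; they are unique because M is torsion free, and uniqueness
   makes [phi] linear. *)
pose phi x := projT1 (cid (H x)) : R^o.
have phiE x : x = phi x *: e by rewrite /phi; case: cid.
have sI r s : r *: e = s *: e -> r = s.
  move/eqP; rewrite -subr_eq0 -scalerBl => /eqP re; apply/eqP; rewrite -subr_eq0.
  apply: contraT => rs; case/eqP: e0.
  exact: (invertible_torsion_free bf rs re).
have lphi : linear phi.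
  by move=> k x y; apply: sI; rewrite -phiE scalerDl -scalerA -!phiE.
pose phiL := HB.pack_for {linear M -> R^o} phi
  (GRing.isLinear.Build R M R^o *:%R phi lphi).
exists e, phiL; split=> //=.
by apply: sI; rewrite -phiE scale1r.
Qed.

(** * Powers of principal ideals, and elements with associate powers *)

Section PrincipalIdeals.
Variable R : idomainType.
Implicit Types x y : R.

(** Mutual divisibility gives x = l k x, and cancelling x makes k a unit; for x = 0 the unit 1
    serves. *)
Lemma pidealP x y :
  pideal x = pideal y <-> exists2 k : R, k \is a GRing.unit & y = k * x.
Proof.
split=> [e|[k ku ->]]; last first.
  apply/seteqP; split=> z [r ->]; last by exists (r * k); rewrite mulrA.
  by exists (r * k^-1); rewrite mulrA mulrVK.
have [k ky] : pideal x y by rewrite e; exists 1; rewrite mul1r.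
have [l lx] : pideal y x by rewrite -e; exists 1; rewrite mul1r.
have [x0|x0] := eqVneq x 0; first by exists 1; rewrite ?unitr1 // ky x0 !mulr0.
exists k => //; apply/unitrPr; exists l; apply: (mulIf x0).
by rewrite mul1r [RHS]lx ky mulrA [k * l]mulrC.
Qed.

Lemma pideal_is_ideal x : is_ideal (pideal x).
Proof.
split=> [|_ _ [r ->] [s ->]|k _ [r ->]]; first by exists 0; rewrite mul0r.
- by exists (r + s); rewrite mulrDl.
- by exists (k * r); rewrite mulrA.
Qed.

Lemma ideal_pow_pideal x n : ideal_pow (pideal x) n = pideal (x ^+ n).
Proof.
elim: n => [|n IH] /=.
  by apply/seteqP; split=> // z _; exists z; rewrite expr0 mulr1.
rewrite IH; apply/seteqP; split=> z.
  case=> w hw ->; rewrite big_seq; elim/big_rec: _ => [|p y pw [r ->]].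
    by exists 0; rewrite mul0r.
  have [[s ->] [t ->]] := hw p pw; exists (s * t + r).
  by rewrite mulrDl exprS mulrACA.
case=> r ->; exists [:: (r * x, x ^+ n)]; last by rewrite big_seq1 -mulrA -exprS.
by move=> p /[!inE] /eqP -> /=; split; [exists r | exists 1; rewrite mul1r].
Qed.

Lemma is_ideal_power_unit n x : x \is a GRing.unit -> is_ideal_power n (pideal x).
Proof.
move=> xu; exists (pideal 1); first exact: pideal_is_ideal.
by rewrite ideal_pow_pideal expr1n; apply/esym/pidealP; exists x; rewrite ?mulr1.
Qed.

Lemma is_ideal_power0 n : (0 < n)%N -> is_ideal_power n (pideal (0 : R)).
Proof.
move=> n0; exists (pideal 0); first exact: pideal_is_ideal.
by rewrite ideal_pow_pideal expr0n eqn0Ngt n0.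
Qed.

(** Generators of the same ideal differ by a unit. The right-hand side is the equation satisfied by
    the coordinates of a root stack object. *)
Lemma is_ideal_power_pideal (hR : is_pir R) n x :
  is_ideal_power n (pideal x) <->
  exists l u : R, u \is a GRing.unit /\ l ^+ n = u * x.
Proof.
split=> [[J /hR[l ->]]|[l [u [uu e]]]].
  by rewrite ideal_pow_pideal => /pidealP[u uu e]; exists l, u.
exists (pideal l); first exact: pideal_is_ideal.
by rewrite ideal_pow_pideal; apply/pidealP; exists u.
Qed.

(** g generates the ideal (x, y); p and q are the cofactors of x and y. *)
Lemma pir_bezout (hR : is_pir R) x y :
  exists g p q a b : R, [/\ x = p * g, y = q * g & g = a * x + b * y]%classic.
Proof.
have [|g hg] := hR [set z | exists a b, z = a * x + b * y]%classic.
  split=> [|_ _ [a [b ->]] [a' [b' ->]]|k _ [a [b ->]]].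
  - by exists 0, 0; ring.
  - by exists (a + a'), (b + b'); ring.
  - by exists (k * a), (k * b); ring.
have [p hp] : pideal g x by rewrite -hg; exists 1, 0; ring.
have [q hq] : pideal g y by rewrite -hg; exists 0, 1; ring.
have : pideal g g by exists 1; rewrite mul1r.
by rewrite -hg => -[a [b hab]]; exists g, p, q, a, b.
Qed.

Lemma bezout_expr (x y : R) n :
  (exists a b, a * x + b * y = 1) -> exists a b, a * x + b * y ^+ n = 1.
Proof.
move=> [a [b e]]; elim: n => [|n [a' [b' IH]]].
  by exists 0, 1; rewrite expr0; ring.
(* Expand (a x + b y)(a' x + b' y^n) = 1 and collect the multiples of x. *)
exists (a * (a' * x + b' * y ^+ n) + b * y * a'), (b * b').
by rewrite -[RHS]mulr1 -{1}e -IH exprS; ring.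
Qed.

(** x is coprime to y^n, yet divides it since n > 0; hence x divides 1. *)
Lemma unit_of_coprime_expr (x y u : R) n : (0 < n)%N ->
  (exists a b, a * x + b * y = 1) -> y ^+ n = u * x ^+ n -> x \is a GRing.unit.
Proof.
case: n => // n _ /(@bezout_expr _ _ n.+1)[a [b e]] h.
by apply/unitrPr; exists (a + b * u * x ^+ n); rewrite -e h exprS; ring.
Qed.

(** Bezout does the work of unique factorization: after division by the gcd, the cofactors are
    coprime with associate n-th powers, so both are units. *)
Lemma pir_expr_assoc (hR : is_pir R) (x y u : R) n :
  (0 < n)%N -> u \is a GRing.unit -> y ^+ n = u * x ^+ n ->
  exists2 w : R, w \is a GRing.unit & y = w * x.
Proof.
move=> n0 uu e; have [g [p [q [a [b [hx hy hg]]]]]] := pir_bezout hR x y.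
have [g0|g0] := eqVneq g 0.
  by exists 1; rewrite ?unitr1 // hx hy g0 !mulr0.
have ab1 : a * p + b * q = 1.
  by apply: (mulIf g0); rewrite mul1r {2}hg hx hy; ring.
have epq : q ^+ n = u * p ^+ n.
  apply: (mulIf (expf_neq0 n g0)); rewrite -exprMn -hy e hx exprMn; ring.
have pu : p \is a GRing.unit.
  by apply: (unit_of_coprime_expr n0 _ epq); exists a, b.
have qu : q \is a GRing.unit.
  apply: (@unit_of_coprime_expr _ p u^-1 _ n0); last by rewrite epq mulKr.
  by exists b, a; rewrite addrC.
exists (q * p^-1); first by rewrite unitrM qu unitrV.
by rewrite hy hx mulrA mulrVK.
Qed.
End PrincipalIdeals.

(** * Root stack objects in coordinates *)

Section RootObjects.
Variables (R : idomainType) (D : modform R) (d : D) (psi : {linear D -> R^o}).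
Hypothesis bd : is_basis1 d psi.
Variable r : nat.
Implicit Types y : root_obj D r.

(* In terms of a generator e of the line bundle, the form is e |-> l and sigma is
   e^r |-> u d. *)
Definition root_datum y (l u : R) : Prop :=
  exists (e : y) (phi : {linear y -> R^o}),
    [/\ is_basis1 e phi, mf_form y e = l & ro_sigma y (tpow_gen e r) = u *: d].

Lemma basis1_scaleI (M : lmodType R) (e : M) (phi : {linear M -> R^o}) (k l : R) :
  is_basis1 e phi -> k *: e = l *: e -> k = l.
Proof.
move=> [h _] /(congr1 phi); rewrite !linearZ /= h /GRing.scale /=.
by rewrite !mulr1.
Qed.

(** The inverse of k is the coordinate of the preimage of e'. *)
Lemma basis1_unit (M N : lmodType R) (e : M) (phi : {linear M -> R^o})
    (e' : N) (phi' : {linear N -> R^o}) (f : {linear M -> N}) (k : R) :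
  is_basis1 e phi -> is_basis1 e' phi' -> f e = k *: e' -> bijective f ->
  k \is a GRing.unit.
Proof.
move=> be be' fe [g fK gK]; apply/unitrPr; exists (phi (g e')).
apply: (basis1_scaleI be'); rewrite scale1r mulrC -scalerA -fe -linearZ /=.
by rewrite -be.2 gK.
Qed.

Lemma root_datum_exists (hR : is_pir R) y :
  exists l (u : units R), root_datum y l (val u).
Proof.
have [e [phi be]] := invertible_basis1 hR (ro_inv y).
have bt := basis1_tpow r be.
have [bs _] := ro_iso y.
have hu := basis1_unit bt bd (bd.2 _) bs.
exists (mf_form y e), (exist (fun x : R => x \is a GRing.unit) _ hu); exists e, phi; split=> //=.
exact: bd.2.
Qed.

(** This is the compatibility of sigma with the forms, read at the generator e^r. *)
Lemma root_datum_eq y l u : root_datum y l u -> l ^+ r = u * mf_form D d.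
Proof.
move=> [e [phi [be <- hs]]]; have [_ h] := ro_iso y.
have := h (tpow_gen e r); rewrite /= hs => {}h.
by rewrite -tpow_form_gen h linearZ.
Qed.

(** An isomorphism is determined by the unit w with f(e') = w e. The two compatibilities are
    equalities of linear maps on free modules of rank one, so they need only be read at
    generators. *)
Lemma root_isomP y' y l' u' l u : root_datum y' l' u' -> root_datum y l u ->
  root_isom y' y <->
  exists w, [/\ w \is a GRing.unit, l' = w * l & u' = w ^+ r * u].
Proof.
move=> [e' [phi' [be' hl' hs']]] [e [phi [be hl hs]]]; split.
  move=> [f [[bf hf] hfs]]; have fe := be.2 (f e'); exists (phi (f e')); split.
  - exact: basis1_unit be' be fe bf.
  - by rewrite -hl' hf {1}fe linearZ hl.
  - apply: (basis1_scaleI bd); rewrite -hs' hfs (tpow_map_gen _ fe) linearZ /= hs.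
    by rewrite scalerA.
move=> [w [wu el eu]].
pose f0 x := (w * phi' x) *: e.
have lf0 : linear f0.
  by move=> k x z; rewrite /f0 linearP mulrDr scalerDl scalerA; congr (_ *: _ + _);
     rewrite /GRing.scale /= mulrCA.
pose f := HB.pack_for {linear y' -> y} f0
  (GRing.isLinear.Build R y' y *:%R f0 lf0).
have fe : f e' = w *: e by rewrite /f /= /f0 be'.1 mulr1.
exists f; split; first split.
- exists (fun z : y => (w^-1 * phi z) *: e') => x.
    rewrite /f /= /f0 linearZ /= be.1 /GRing.scale /= mulr1 mulKr //.
    exact/esym/be'.2.
  rewrite /f /= /f0 linearZ /= be'.1 /GRing.scale /= mulr1 mulVKr //.
  exact/esym/be.2.
- apply: (@basis1_linear_ext _ _ _ e' phi' (mf_form y') (mf_form y \o f)) => //.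
  by rewrite hl' -[RHS]/(mf_form y (f e')) fe linearZ /= hl el.
- apply: (@basis1_linear_ext _ _ _ _ _ (ro_sigma y') (ro_sigma y \o tpow_map f r)).
    exact: (basis1_tpow r be').
  by rewrite hs' -[RHS]/(ro_sigma y (tpow_map f r _)) (tpow_map_gen _ fe) linearZ /= hs scalerA eu.
Qed.

(** The object is R itself with multiplication by l as its form, and sigma sends the r-th tensor
    power of 1 to u d. *)
Lemma root_datum_build l u : u \is a GRing.unit -> l ^+ r = u * mf_form D d ->
  exists y, root_datum y l u.
Proof.
move=> uu e.
pose lam0 (x : R^o) : R^o := l * x.
have llam : linear lam0.
  by move=> k x z; rewrite /lam0 /GRing.scale /=; ring.
pose lam := HB.pack_for {linear R^o -> R^o} lam0
  (GRing.isLinear.Build R R^o R^o *:%R lam0 llam).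
pose M := @ModForm R R^o lam.
have bt := @basis1_tpow _ (R^o) _ _ r (basis1_regular R).
set tau := tpow_form _ r in bt.
pose sig0 (x : modform_pow M r) : D := (u * tau x) *: d.
have lsig : linear sig0.
  move=> k x z; rewrite /sig0 linearP mulrDr scalerDl scalerA.
  by congr (_ *: _ + _); rewrite /GRing.scale /= mulrCA.
pose sig := HB.pack_for {linear modform_pow M r -> D} sig0
  (GRing.isLinear.Build R (modform_pow M r) D *:%R sig0 lsig).
have sigE : sig (tpow_gen (1 : R^o) r) = u *: d.
  by rewrite /sig /= /sig0 bt.1 mulr1.
have siso : is_modform_iso sig.
  split.
    exists (fun z : D => (u^-1 * psi z) *: tpow_gen (1 : R^o) r) => x.
      rewrite /sig /= /sig0 linearZ /= bd.1 /GRing.scale /= mulr1 mulKr //.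
      exact/esym/bt.2.
    rewrite /sig /= /sig0 linearZ /= bt.1 /GRing.scale /= mulr1 mulVKr //.
    exact/esym/bd.2.
  apply: (@basis1_linear_ext _ _ _ _ _ (mf_form (modform_pow M r)) (mf_form D \o sig) bt).
  rewrite -[RHS]/(mf_form D (sig _)) sigE linearZ /= tpow_form_gen /= /lam0 mulr1.
  exact: e.
exists (RootObj (@invertible_regular R : invertible_module M) siso).
exists (1 : R^o), idfun; split=> //; first exact: basis1_regular.
by rewrite /= /lam0 mulr1.
Qed.

Lemma root_isom_sym (hR : is_pir R) y y' : root_isom y y' -> root_isom y' y.
Proof.
have [l [u hy]] := root_datum_exists hR y.
have [l' [u' hy']] := root_datum_exists hR y'.
move=> /(root_isomP hy hy')[w [wu el eu]]; apply/(root_isomP hy' hy).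
by exists w^-1; rewrite unitrV el eu exprVn !mulKr // unitrX.
Qed.

Lemma root_isom_trans (hR : is_pir R) y1 y2 y3 :
  root_isom y1 y2 -> root_isom y2 y3 -> root_isom y1 y3.
Proof.
have [l [u h1]] := root_datum_exists hR y1.
have [l' [u' h2]] := root_datum_exists hR y2.
have [l'' [u'' h3]] := root_datum_exists hR y3.
move=> /(root_isomP h1 h2)[w [wu el eu]] /(root_isomP h2 h3)[w' [wu' el' eu']].
by apply/(root_isomP h1 h3); exists (w * w'); rewrite unitrM wu el el' eu eu' exprMn !mulrA.
Qed.

Lemma root_obj_exists (hR : is_pir R) :
  inhabited (root_obj D r) <-> is_ideal_power r (pideal (mf_form D d : R)).
Proof.
split=> [[y]|/(is_ideal_power_pideal hR)[l [u [uu e]]]].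
  have [l [u h]] := root_datum_exists hR y.
  apply/(is_ideal_power_pideal hR); exists l, (val u).
  by split; [exact: valP | exact: root_datum_eq h].
by have [y _] := root_datum_build uu e.
Qed.

Hypothesis r0 : (0 < r)%N.

(** l^r and l'^r are both associate to the value of the form at d, so l' = w l for a unit w;
    cancelling that nonzero value then gives u' = w^r u. *)
Lemma root_obj_unique (hR : is_pir R) y y' : mf_form D d != 0 -> root_isom y' y.
Proof.
move=> d0; have [l [u hy]] := root_datum_exists hR y.
have [l' [u' hy']] := root_datum_exists hR y'.
have e := root_datum_eq hy; have e' := root_datum_eq hy'.
have ev : l' ^+ r = (val u' * (val u)^-1) * l ^+ r.
  by rewrite e e' mulrA mulrVK //; exact: valP.
have [|w wu ew] := pir_expr_assoc hR r0 _ ev.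
  by rewrite unitrM unitrV (valP u) (valP u').
apply/(root_isomP hy' hy); exists w; split=> //.
by apply: (mulIf d0); rewrite -e' ew exprMn e mulrA.
Qed.

Section DegenerateForm.
Variables (D0 : forall x, mf_form D x = 0) (hR : is_pir R).

Lemma root_datum_twist u y l v :
  root_datum y l v -> root_datum (root_twist D0 u y) l (val u * v).
Proof.
move=> [e [phi [be hl hs]]]; exists e, phi; split=> //.
by rewrite /= hs scalerA.
Qed.

(** When the form vanishes, this class is a complete isomorphism invariant and twisting translates
    it, which is the source of the torsors. *)
Definition root_class y : units_mod R r :=
  to_units_mod r (projT1 (cid (projT2 (cid (root_datum_exists hR y))))).

(** Two data of one object are related by its identity map, so their units differ by an r-th power
    and the chosen datum is immaterial. *)
Lemma root_class_datum y l (u : units R) :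
  root_datum y l (val u) -> root_class y = to_units_mod r u.
Proof.
rewrite /root_class; case: cid => l' h' /=; case: cid => u' h /= hy.
have [w [wu _ e]] := (root_isomP hy h).1 (root_isom_refl y).
by apply/to_units_modP; exists (exist (fun x : R => x \is a GRing.unit) w wu); rewrite mulrC.
Qed.

Lemma root_isom_class y y' : root_isom y y' <-> root_class y = root_class y'.
Proof.
have [l [u hy]] := root_datum_exists hR y.
have [l' [u' hy']] := root_datum_exists hR y'.
rewrite (root_class_datum hy) (root_class_datum hy').
split=> [h|/esym/to_units_modP[w e]].
  have [w [wu _ e]] := (root_isomP hy hy').1 h.
  by apply/esym/to_units_modP; exists (exist (fun x : R => x \is a GRing.unit) w wu); rewrite mulrC.
apply/(root_isomP hy hy'); exists (val w).
split; [exact: valP | | by rewrite mulrC; exact: e].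
(* Here l^r = 0 with r > 0, so l = 0 and only the condition on units remains. *)
have lz l1 u1 y1 : root_datum y1 l1 u1 -> l1 = 0.
  by move=> /root_datum_eq/eqP; rewrite D0 mulr0 expf_eq0 r0 => /eqP.
by rewrite (lz _ _ _ hy) (lz _ _ _ hy') mulr0.
Qed.

Lemma root_class_twist u y :
  root_class (root_twist D0 u y) = (to_units_mod r u * root_class y)%g.
Proof.
have [l [v hy]] := root_datum_exists hR y.
have ht := @root_datum_twist u _ _ _ hy.
rewrite (root_class_datum hy) -[RHS]to_units_modM.
exact: (@root_class_datum _ l (unitsM u v)).
Qed.
End DegenerateForm.
End RootObjects.

(** * The projective line over a ring and over its fraction field *)

Section ProjectiveLine.
Variable R : comUnitRingType.

Lemma p1_mk_eqP (s t s' t' : R) (h : unimodular (s, t)) (h' : unimodular (s', t')) :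
  p1_mk h = p1_mk h' <->
  exists2 k : R, k \is a GRing.unit & (s', t') = (k * s, k * t).
Proof. by split=> [/eqmodP/asboolP|e] //; apply/eqmodP/asboolP. Qed.

Lemma p1_mk_rep (Q : p1 R) (h : unimodular ((p1_rep Q).1, (p1_rep Q).2)) :
  p1_mk h = Q.
Proof.
rewrite -[RHS]reprK; congr (\pi_(p1 R)%qT _); apply: val_inj => /=.
by rewrite -surjective_pairing.
Qed.

Lemma p1_mk_surj (Q : p1 R) : exists s t (h : unimodular (s, t)), Q = p1_mk h.
Proof.
have h : unimodular ((p1_rep Q).1, (p1_rep Q).2) by exact: p1_repP.
by exists (p1_rep Q).1, (p1_rep Q).2, h; rewrite p1_mk_rep.
Qed.

End ProjectiveLine.

Lemma p1_map_mk (R S : comUnitRingType) (f : {rmorphism R -> S}) (s t : R)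
    (h : unimodular (s, t)) (h' : unimodular (f s, f t)) :
  p1_map f (p1_mk h) = p1_mk h'.
Proof.
have [k ku e] := p1_rep_mk h.
apply/esym/p1_mk_eqP; exists (f k); first exact: rmorph_unit.
by rewrite e /= !rmorphM.
Qed.

Lemma bijective_of_inj_surj (T U : Type) (f : T -> U) :
  injective f -> (forall u, exists t, f t = u) -> bijective f.
Proof.
move=> fI fs; exists (fun u => projT1 (cid (fs u))) => x; last by case: cid.
by case: cid => y /= /fI.
Qed.

Lemma fraction_clear_denom (R : idomainType) (z : {fraction R}) :
  exists n d : R, d != 0 /\ z * tofrac d = tofrac n.
Proof.
elim/quotW: z => x; exists \n_x, \d_x; split; first exact: denom_ratioP.
unlock tofrac; rewrite -[LHS]FracField.pi_mul; apply/eqmodP.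
rewrite /= FracField.equivfE /FracField.mulf.
by rewrite !numden_Ratio ?oner_eq0 ?mulf_neq0 ?denom_ratioP ?oner_eq0 // !mulr1 mulrC.
Qed.

(** Injectivity: a scalar of K relating two unimodular pairs is a unit of R, by their Bezout
    relations. Surjectivity: clear denominators and divide by the gcd. *)
Lemma p1_map_tofrac_bij (R : idomainType) (hR : is_pir R) :
  bijective (p1_map (@tofrac R) : p1 R -> p1 {fraction R}).
Proof.
have fh (s t : R) : unimodular (s, t) -> unimodular (tofrac s, tofrac t).
  exact: (@unimodular_morph _ _ (@tofrac R) (s, t)).
apply: bijective_of_inj_surj => [Q Q'|Q].
  have [s [t [h ->]]] := p1_mk_surj Q; have [s' [t' [h' ->]]] := p1_mk_surj Q'.
  rewrite (p1_map_mk h (fh _ _ h)) (p1_map_mk h' (fh _ _ h')).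
  case/p1_mk_eqP=> k ku [es et].
  have [x [y /= e]] := h; have [x' [y' /= e']] := h'.
  (* Multiply x s + y t = 1 by k; the inverse of k comes likewise from the relation for (s', t'). *)
  have ek : k = tofrac (x * s' + y * t').
    rewrite tofracD !tofracM es et [k * tofrac s]mulrC [k * tofrac t]mulrC.
    by rewrite !mulrA -mulrDl -!tofracM -tofracD e tofrac1 mul1r.
  have ek' : k^-1 = tofrac (x' * s + y' * t).
    apply: (mulIr ku); rewrite mulVr // -(tofrac1 R) -e'.
    rewrite !tofracD !tofracM es et; ring.
  have kk : (x * s' + y * t') * (x' * s + y' * t) = 1.
    by apply/eqP; rewrite -tofrac_eq; apply/eqP; rewrite tofracM tofrac1 -ek -ek' mulrV.
  apply/p1_mk_eqP; exists (x * s' + y * t').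
    by apply/unitrPr; exists (x' * s + y' * t).
  by congr pair; apply/eqP; rewrite -tofrac_eq; apply/eqP; rewrite tofracM -ek ?es ?et.
have [al [be [h ->]]] := p1_mk_surj Q.
have [n1 [d1 [d10 e1]]] := fraction_clear_denom al.
have [n2 [d2 [d20 e2]]] := fraction_clear_denom be.
have c0 : tofrac (d1 * d2) != 0 :> {fraction R} by rewrite tofrac_eq0 mulf_neq0.
(* With al = n1/d1 and be = n2/d2, these are the coordinates multiplied by d1 d2; the cofactors p, q
   will be the primitive coordinates. *)
have [g [p [q [a [b [hA hB hg]]]]]] := pir_bezout hR (n1 * d2) (n2 * d1).
have eal : al * tofrac (d1 * d2) = tofrac p * tofrac g.
  by rewrite -tofracM -hA !tofracM mulrA e1.
have ebe : be * tofrac (d1 * d2) = tofrac q * tofrac g.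
  by rewrite -tofracM -hB !tofracM [tofrac d1 * _]mulrC mulrA e2.
have g0 : g != 0.
  apply/eqP => g0; have [x [y /= e]] := h; case/eqP: c0.
  have hz (z w : {fraction R}) : z * tofrac (d1 * d2) = w * tofrac g ->
      z * tofrac (d1 * d2) = 0 by rewrite g0 tofrac0 mulr0.
  rewrite -[LHS]mul1r -e mulrDl -!mulrA (hz _ _ eal) (hz _ _ ebe).
  by rewrite !mulr0 addr0.
have u : unimodular (p, q).
  by exists a, b; apply: (mulIf g0); rewrite /= mul1r {2}hg hA hB; ring.
exists (p1_mk u); rewrite (p1_map_mk u (fh _ _ u)).
apply: (p1_mk_eqP _ _).2; exists (tofrac g / tofrac (d1 * d2)).
  by rewrite unitfE mulf_neq0 ?invr_eq0 // tofrac_eq0.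
by congr pair; apply: (mulIf c0); rewrite ?eal ?ebe mulrAC mulfVK // mulrC.
Qed.

(** * Torsors from a complete invariant *)

Section Torsor.
Variables (R : comUnitRingType) (n : nat) (X Y : Type) (q : Y -> X).
Variables (tw : units R -> Y -> Y) (kappa : Y -> units_mod R n).
Hypotheses (Y0 : inhabited Y) (q_surj : forall x, exists y, q y = x).
Hypothesis qP : forall y y', q y = q y' <-> kappa y = kappa y'.
Hypothesis kappa_tw : forall u y, kappa (tw u y) = (to_units_mod n u * kappa y)%g.

(** [kappa] embeds X in the group, and twisting becomes translation; its image is nonempty and
    stable under translation, so X is a torsor. *)
Lemma torsor_of_invariant :
  exists2 act : units_mod R n -> X -> X, is_torsor act &
    forall u y, act (to_units_mod n u) (q y) = q (tw u y).
Proof.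
pose rep x := projT1 (cid (q_surj x)).
have repK x : q (rep x) = x by rewrite /rep; case: cid.
have kq y : kappa (rep (q y)) = kappa y by apply/qP; rewrite repK.
have toK (g : units_mod R n) : to_units_mod n (repr g) = g by exact: reprK.
(* Representatives of g and x are chosen; since [kappa] is complete, the result does not depend on
   them. *)
pose act (g : units_mod R n) x := q (tw (repr g) (rep x)).
have ka g x : kappa (rep (act g x)) = (g * kappa (rep x))%g.
  by rewrite kq kappa_tw toK.
have xI x x' : kappa (rep x) = kappa (rep x') -> x = x'.
  by move/qP; rewrite !repK.
exists act; last by move=> u y; apply/qP; rewrite !kappa_tw toK kq.
split.
- by case: Y0 => y; exact: inhabits (q y).
- by move=> x; apply: xI; rewrite ka mul1g.
- by move=> g h x; apply: xI; rewrite !ka mulgA.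
- move=> x y; exists (kappa (rep y) * (kappa (rep x))^-1)%g; split.
    by apply: xI; rewrite ka -mulgA mulVg mulg1.
  by move=> g <-; rewrite ka -mulgA mulgV mulg1.
Qed.
End Torsor.

(** * The pulled back line bundle and its generator *)

Section Line.
Variables (R : comUnitRingType) (Q : p1 R).

Fact line_gen_proof : (p1_rep Q : R^o * R^o) \in in_line Q.
Proof. by apply/asboolP; exists 1; rewrite !mul1r -surjective_pairing. Qed.

Definition line_gen : line Q := exist _ (p1_rep Q : R^o * R^o) line_gen_proof.

(** A Bezout relation x s + y t = 1 gives the coordinate: (v1, v2) goes to x v1 + y v2, which sends
    r (s, t) to r. *)
Lemma line_basis1 : exists psi : {linear line Q -> R^o}, is_basis1 line_gen psi.
Proof.
have [x [y e]] := p1_repP Q.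
pose psi0 (v : line Q) : R^o := x * (val v).1 + y * (val v).2.
have lpsi : linear psi0.
  by move=> k v w; rewrite /psi0 /= /GRing.scale /=; ring.
exists (HB.pack_for {linear line Q -> R^o} psi0
  (GRing.isLinear.Build R (line Q) R^o *:%R psi0 lpsi)).
split=> //= v; apply: val_inj; have /asboolP[r er] := valP v.
have -> : psi0 v = r.
  by rewrite /psi0 er /= -[RHS]mulr1 -e; ring.
exact: er.
Qed.
End Line.

(** * The three marked points *)

Section MarkedPoints.
Variable R : idomainType.
Implicit Types Q : p1 R.

(** The stored representative of the marked point is a unit multiple of the standard one, and the
    unit disappears in the ideal. *)
Lemma inter_ideal_0 Q : inter_ideal (P_0 R) Q = pideal (form_0 (p1_rep Q) : R).
Proof.
rewrite /inter_ideal; have [k ku ->] := p1_rep_mk (unimod01 R).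
by apply/esym/pidealP; exists k => //=; rewrite /form_0; ring.
Qed.

Lemma inter_ideal_1 Q : inter_ideal (P_1 R) Q = pideal (form_1 (p1_rep Q) : R).
Proof.
rewrite /inter_ideal; have [k ku ->] := p1_rep_mk (unimod11 R).
by apply/esym/pidealP; exists k => //=; rewrite /form_1; ring.
Qed.

Lemma inter_ideal_oo Q : inter_ideal (P_oo R) Q = pideal (form_oo (p1_rep Q) : R).
Proof.
rewrite /inter_ideal; have [k ku ->] := p1_rep_mk (unimod10 R).
by apply/esym/pidealP; exists (- k); rewrite ?unitrN //= /form_oo; ring.
Qed.

Lemma pideal_form_mk (F : {linear (R^o * R^o)%type -> R^o}) (s t : R)
    (h : unimodular (s, t)) :
  pideal (F (p1_rep (p1_mk h)) : R) = pideal (F (s, t) : R).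
Proof.
have [k ku ->] := p1_rep_mk h; apply/esym/pidealP; exists k => //.
by rewrite -[(k * s, k * t)]/(k *: ((s, t) : (R^o * R^o)%type)) linearZ.
Qed.

(** If s = 0, unimodularity makes t a unit, and (0, t) = t (0, 1). The other two marked points are
    treated alike. *)
Lemma form_0_eq0 Q : (form_0 (p1_rep Q) : R) = 0 -> Q = P_0 R.
Proof.
have [s [t [h ->]]] := p1_mk_surj Q; have [k ku ->] := p1_rep_mk h.
rewrite /form_0 /= => /eqP; rewrite mulrI_eq0; last exact: mulrI.
move=> /eqP s0; apply/esym/p1_mk_eqP; exists t; last by rewrite s0 mulr0 mulr1.
have [x [y /= e]] := h; apply/unitrPr; exists y.
by rewrite -e s0 mulr0 add0r mulrC.
Qed.

Lemma form_1_eq0 Q : (form_1 (p1_rep Q) : R) = 0 -> Q = P_1 R.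
Proof.
have [s [t [h ->]]] := p1_mk_surj Q; have [k ku ->] := p1_rep_mk h.
rewrite /form_1 /= => /eqP; rewrite subr_eq0 => /eqP /(mulrI ku) st.
apply/esym/p1_mk_eqP; exists t; last by rewrite st mulr1.
have [x [y /= e]] := h; apply/unitrPr; exists (x + y).
by rewrite -e st; ring.
Qed.

Lemma form_oo_eq0 Q : (form_oo (p1_rep Q) : R) = 0 -> Q = P_oo R.
Proof.
have [s [t [h ->]]] := p1_mk_surj Q; have [k ku ->] := p1_rep_mk h.
rewrite /form_oo /= => /eqP; rewrite mulrI_eq0; last exact: mulrI.
move=> /eqP t0; apply/esym/p1_mk_eqP; exists s; last by rewrite t0 mulr0 mulr1.
have [x [y /= e]] := h; apply/unitrPr; exists x.
by rewrite -e t0 mulr0 addr0 mulrC.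
Qed.

Lemma P_0_neq_P_1 : P_0 R <> P_1 R.
Proof. by case/p1_mk_eqP=> k _ [/eqP]; rewrite mulr0 oner_eq0. Qed.
Lemma P_0_neq_P_oo : P_0 R <> P_oo R.
Proof. by case/p1_mk_eqP=> k _ [/eqP]; rewrite mulr0 oner_eq0. Qed.
Lemma P_1_neq_P_oo : P_1 R <> P_oo R.
Proof. by case/p1_mk_eqP=> k _ [<- /eqP]; rewrite eq_sym oner_eq0. Qed.
End MarkedPoints.

(** * Points of the Belyi stack over the projective line *)

Section Belyi.
Variables (R : idomainType) (hR : is_pir R) (a b c : nat).
Implicit Types Q : p1 R.

(** The transport along e allows case analysis on [belyi_isom] with general indices; for equal base
    points proof irrelevance removes it. *)
Lemma belyi_isom_components (x y : belyi_pt R a b c) : belyi_isom x y ->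
  forall e : projT1 x = projT1 y,
  let x' := eq_rect _ (fun Q => belyi_obj a b c Q) (projT2 x) _ e in
  let y' := projT2 y in
  [/\ root_isom (bel_0 x') (bel_0 y'), root_isom (bel_1 x') (bel_1 y')
    & root_isom (bel_oo x') (bel_oo y')].
Proof. by case=> Q y' y'' h0 h1 hoo e; rewrite (Prop_irrelevance e erefl). Qed.

Lemma belyi_isomP Q (y y' : belyi_obj a b c Q) :
  belyi_isom (existT _ Q y) (existT _ Q y') <->
  [/\ root_isom (bel_0 y) (bel_0 y'), root_isom (bel_1 y) (bel_1 y')
    & root_isom (bel_oo y) (bel_oo y')].
Proof.
by split=> [/belyi_isom_components/(_ erefl)//|[h0 h1 hoo]]; apply: BelyiIsom.
Qed.

Lemma belyi_isom_sym (x y : belyi_pt R a b c) : belyi_isom x y -> belyi_isom y x.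
Proof.
case=> Q y' y'' h0 h1 hoo; have [psi bd] := line_basis1 Q.
by apply: BelyiIsom; apply: (@root_isom_sym _ (pullback_div _ Q) _ _ bd _ hR).
Qed.

Lemma belyi_isom_trans (x y z : belyi_pt R a b c) :
  belyi_isom x y -> belyi_isom y z -> belyi_isom x z.
Proof.
case: x y z => [Q x] [Q1 y] [Q2 z] hxy hyz.
have e1 := belyi_isom_base hxy; have e2 := belyi_isom_base hyz.
move: e1 e2 => /= e1 e2; subst Q1 Q2.
have [psi bd] := line_basis1 Q.
move: hxy hyz => /belyi_isomP[h0 h1 hoo] /belyi_isomP[h0' h1' hoo'].
apply: BelyiIsom.
- exact: (@root_isom_trans _ (pullback_div _ Q) _ _ bd _ hR _ _ _ h0 h0').
- exact: (@root_isom_trans _ (pullback_div _ Q) _ _ bd _ hR _ _ _ h1 h1').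
- exact: (@root_isom_trans _ (pullback_div _ Q) _ _ bd _ hR _ _ _ hoo hoo').
Qed.

Lemma to_class_eq (x y : belyi_pt R a b c) :
  to_class x = to_class y <-> belyi_isom x y.
Proof.
split=> [/(congr1 (fun C => sval C x)) /= e|h].
  by rewrite -e; exact: belyi_isom_refl.
(* Classes are predicates, so their equality is extensional and follows from symmetry and
   transitivity. *)
apply: eq_exist; apply/funext => z; apply/propext; split=> h'.
  exact: belyi_isom_trans h' h.
exact: belyi_isom_trans h' (belyi_isom_sym h).
Qed.

Lemma to_class_surj (C : belyi_class R a b c) : exists x, C = to_class x.
Proof. by case: C => C [x e]; exists x; apply: eq_exist. Qed.

Lemma to_fiber_eq Q (y y' : belyi_obj a b c Q) :
  to_fiber y = to_fiber y' <-> belyi_isom (existT _ Q y) (existT _ Q y').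
Proof.
split=> [/(congr1 (fun C => sval C)) /to_class_eq //|h].
by apply: eq_exist; apply/to_class_eq.
Qed.

Lemma to_fiber_surj Q (C : belyi_fiber a b c Q) : exists y, to_fiber y = C.
Proof.
case: C => C eQ; have [[Q' y] eC] := to_class_surj C.
have e : Q' = Q by rewrite -eQ eC belyi_proj_class.
by subst Q'; exists y; apply: eq_exist; rewrite eC.
Qed.

Lemma belyi_class_over Q :
  (exists x : belyi_class R a b c, belyi_proj x = Q) <-> inhabited (belyi_obj a b c Q).
Proof.
split=> [[x e]|[y]]; last by exists (sval (to_fiber y)); exact: svalP (to_fiber y).
by have [y _] := to_fiber_surj (exist _ x e).
Qed.

(** Over a fixed Q the three root objects are independent, so the criterion for one root stack
    applies three times. *)
Lemma belyi_obj_exists Q : inhabited (belyi_obj a b c Q) <->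
  [/\ is_ideal_power a (inter_ideal (P_0 R) Q),
      is_ideal_power b (inter_ideal (P_1 R) Q)
    & is_ideal_power c (inter_ideal (P_oo R) Q)].
Proof.
have [psi bd] := line_basis1 Q.
rewrite inter_ideal_0 inter_ideal_1 inter_ideal_oo.
have H F n := @root_obj_exists _ (pullback_div F Q) _ _ bd n hR.
split=> [[[y0 y1 yoo]]|[/(H _ _)[y0] /(H _ _)[y1] /(H _ _)[yoo]]].
  by split; apply/(H _ _).
by exists.
Qed.

Hypotheses (ha : (0 < a)%N) (hb : (0 < b)%N) (hc : (0 < c)%N).

(** Away from P the form is nonzero on the generator of the line, where root objects are unique. *)
Lemma root_isom_away (F : {linear (R^o * R^o)%type -> R^o}) Q P n
    (y y' : root_obj (pullback_div F Q) n) :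
  (0 < n)%N -> ((F (p1_rep Q) : R) = 0 -> Q = P) -> Q <> P -> root_isom y y'.
Proof.
move=> n0 hF QP; have [psi bd] := line_basis1 Q.
by apply: (@root_obj_unique _ (pullback_div F Q) _ _ bd _ n0 hR); apply/eqP => /hF.
Qed.

Lemma root_isom_away_0 Q (y y' : root_obj (pullback_div (@form_0 R) Q) a) :
  Q <> P_0 R -> root_isom y y'.
Proof. exact/root_isom_away/form_0_eq0. Qed.
Lemma root_isom_away_1 Q (y y' : root_obj (pullback_div (@form_1 R) Q) b) :
  Q <> P_1 R -> root_isom y y'.
Proof. exact/root_isom_away/form_1_eq0. Qed.
Lemma root_isom_away_oo Q (y y' : root_obj (pullback_div (@form_oo R) Q) c) :
  Q <> P_oo R -> root_isom y y'.
Proof. exact/root_isom_away/form_oo_eq0. Qed.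

(** At a marked point the values of s, s - t, t are 0, 1 or -1, so each ideal is zero or the whole
    ring, and both are powers. *)
Lemma is_ideal_power_marked Q : [\/ Q = P_0 R, Q = P_1 R | Q = P_oo R] ->
  [/\ is_ideal_power a (inter_ideal (P_0 R) Q),
      is_ideal_power b (inter_ideal (P_1 R) Q)
    & is_ideal_power c (inter_ideal (P_oo R) Q)].
Proof.
rewrite inter_ideal_0 inter_ideal_1 inter_ideal_oo.
have h0 (n : nat) (x : R) : (0 < n)%N -> x = 0 -> is_ideal_power n (pideal x).
  by move=> n0 ->; apply: is_ideal_power0.
case=> ->; rewrite !pideal_form_mk /= /form_1 /= ?(subrr, subr0, sub0r); split;
  first [by apply: h0 | by apply: is_ideal_power_unit; rewrite ?unitrN unitr1].
Qed.

(** [sel] extracts the component whose form vanishes at Q. That component alone decides isomorphism,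
    so its [root_class] is the complete invariant. *)
Lemma fiber_torsor Q n (F : {linear (R^o * R^o)%type -> R^o})
    (D0 : forall x, mf_form (pullback_div F Q) x = 0)
    (sel : belyi_obj a b c Q -> root_obj (pullback_div F Q) n)
    (tw : units R -> belyi_obj a b c Q -> belyi_obj a b c Q) :
  (0 < n)%N -> inhabited (belyi_obj a b c Q) ->
  (forall u y, sel (tw u y) = root_twist D0 u (sel y)) ->
  (forall y y', belyi_isom (existT _ Q y) (existT _ Q y') <->
                root_isom (sel y) (sel y')) ->
  exists2 act : units_mod R n -> belyi_fiber a b c Q -> belyi_fiber a b c Q,
    is_torsor act &
    forall u y, act (to_units_mod n u) (to_fiber y) = to_fiber (tw u y).
Proof.
move=> n0 Q0 hsel hiso; have [psi bd] := line_basis1 Q.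
apply: (@torsor_of_invariant _ _ _ _ _ _
  (fun y => root_class (D := pullback_div F Q) bd hR (sel y))) => //.
- exact: to_fiber_surj.
- by move=> y y'; rewrite to_fiber_eq hiso; exact: root_isom_class.
- by move=> u y; rewrite hsel; exact: root_class_twist.
Qed.
End Belyi.

Theorem lemma3p14 (R : idomainType) (hR : is_pir R) (a b c : nat)
    (ha : (0 < a)%N) (hb : (0 < b)%N) (hc : (0 < c)%N) :
  (* P^1(R) = P^1(K), K the fraction field of R *)
  bijective (p1_map (@tofrac R) : p1 R -> p1 {fraction R}) /\
  (* image *)
  (forall (s t : R) (hst : unimodular (s, t)), let Q := p1_mk hst in
     [/\ inter_ideal (P_0 R) Q = pideal s,
         inter_ideal (P_1 R) Q = pideal (s - t),
         inter_ideal (P_oo R) Q = pideal t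
       & (exists x : belyi_class R a b c, belyi_proj x = Q) <->
         [\/ Q = P_0 R, Q = P_1 R | Q = P_oo R] \/
         [/\ is_ideal_power a (inter_ideal (P_0 R) Q),
             is_ideal_power b (inter_ideal (P_1 R) Q)
           & is_ideal_power c (inter_ideal (P_oo R) Q)]]) /\
  (* injectivity away from the marked points *)
  (forall x y : belyi_class R a b c, belyi_proj x = belyi_proj y ->
     belyi_proj x <> P_0 R -> belyi_proj x <> P_1 R -> belyi_proj x <> P_oo R ->
     x = y) /\
  (* fibers over the marked points *)
  [/\ exists2 act : units_mod R a -> belyi_fiber a b c (P_0 R) -> belyi_fiber a b c (P_0 R),
        is_torsor act &
        forall (u : units R) (y : belyi_obj a b c (P_0 R)),
          act (to_units_mod a u) (to_fiber y) = to_fiber (twist_0 u y),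
      exists2 act : units_mod R b -> belyi_fiber a b c (P_1 R) -> belyi_fiber a b c (P_1 R),
        is_torsor act &
        forall (u : units R) (y : belyi_obj a b c (P_1 R)),
          act (to_units_mod b u) (to_fiber y) = to_fiber (twist_1 u y)
    & exists2 act : units_mod R c -> belyi_fiber a b c (P_oo R) -> belyi_fiber a b c (P_oo R),
        is_torsor act &
        forall (u : units R) (y : belyi_obj a b c (P_oo R)),
          act (to_units_mod c u) (to_fiber y) = to_fiber (twist_oo u y)].
Proof.
split; first exact: p1_map_tofrac_bij.
split.
  move=> s t hst Q; split.
  - by rewrite inter_ideal_0 pideal_form_mk.
  - by rewrite inter_ideal_1 pideal_form_mk.
  - by rewrite inter_ideal_oo pideal_form_mk.
  - rewrite belyi_class_over // belyi_obj_exists //.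
    by split=> [h|[h|//]]; [right | exact: is_ideal_power_marked].
split.
  move=> x y; have [[Q x' ->]] := to_class_surj x.
  have [[Q' y' ->]] := to_class_surj y; rewrite !belyi_proj_class /= => e.
  subst Q' => n0 n1 noo; apply/(to_class_eq hR)/belyi_isomP.
  by split; [exact: root_isom_away_0 | exact: root_isom_away_1 | exact: root_isom_away_oo].
have inh Q : [\/ Q = P_0 R, Q = P_1 R | Q = P_oo R] ->
    inhabited (belyi_obj a b c Q).
  by move=> hQ; apply/(belyi_obj_exists hR); exact: is_ideal_power_marked.
split.
- apply: (fiber_torsor hR (D0 := @form_0_P0 R) (sel := fun y => bel_0 y)) => //.
    by apply: inh; constructor 1.
  (* The marked points are distinct, so the other two components are unique up to isomorphism. *)
  move=> y y'; rewrite belyi_isomP; split=> [[]//|h]; split=> //.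
    by apply: (root_isom_away_1 hR hb); exact: P_0_neq_P_1.
  by apply: (root_isom_away_oo hR hc); exact: P_0_neq_P_oo.
- apply: (fiber_torsor hR (D0 := @form_1_P1 R) (sel := fun y => bel_1 y)) => //.
    by apply: inh; constructor 2.
  move=> y y'; rewrite belyi_isomP; split=> [[]//|h]; split=> //.
    by apply: (root_isom_away_0 hR ha); exact/nesym/P_0_neq_P_1.
  by apply: (root_isom_away_oo hR hc); exact: P_1_neq_P_oo.
- apply: (fiber_torsor hR (D0 := @form_oo_Poo R) (sel := fun y => bel_oo y)) => //.
    by apply: inh; constructor 3.
  move=> y y'; rewrite belyi_isomP; split=> [[]//|h]; split=> //.
    by apply: (root_isom_away_0 hR ha); exact/nesym/P_0_neq_P_oo.
  by apply: (root_isom_away_1 hR hb); exact/nesym/P_1_neq_P_oo.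
Qed.
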